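(* In the edge-distinguishing game (EDGe) played on the cycle $C_6$ (with $\lambda(C_6)$ colors), Player 1 has a winning strategy.
   Context: $C_n$ is the cycle on $n$ vertices. For a positive integer $k$ let $[k]=\{1,\dots,k\}$. A $k$-coloring $c:V(G)\to[k]$ induces $c'(\{u,v\})=\{c(u),c(v)\}$ (a multiset); $c$ is edge-distinguishing if $c'$ is injective, and $\lambda(G)$ is the least $k$ admitting such a coloring. A partial coloring on $U\subseteq V(G)$ has partial induced edge coloring on $G[U]$. EDGe on $G$: two players, Player 1 first, alternately color an uncolored vertex with a color from $[\lambda(G)]$; a move is legal iff afterwards the partial induced edge coloring of the colored vertices is injective. The player making the last legal move wins. A winning strategy guarantees a win regardless of the opponent's play. *)

(* Defs.v *)
From mathcomp Require Import all_boot.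
From mathcomp Require Import finmap multiset.

Set Implicit Arguments.
Unset Strict Implicit.
Unset Printing Implicit Defensive.

Record sgraph := SGraph {
  vertex :> finType;
  adj : rel vertex;
  adj_sym : symmetric adj;
  adj_irrefl : irreflexive adj }.

Definition edges (G : sgraph) : {set {set G}} :=
  [set E : {set G} | [exists u, exists v, adj u v && (E == [set u; v])]].

(* Edges of the induced subgraph G[U]. *)
Definition edges_in (G : sgraph) (U : {set G}) : {set {set G}} :=
  [set E in edges G | E \subset U].

Definition cycle_adj (n : nat) : rel 'I_n :=
  fun i j => (i != j) && ((j == ordS i) || (i == ordS j)).

Lemma cycle_adj_sym n : symmetric (@cycle_adj n).
Proof. by move=> i j; rewrite /cycle_adj eq_sym orbC. Qed.

Lemma cycle_adj_irrefl n : irreflexive (@cycle_adj n).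
Proof. by move=> i; rewrite /cycle_adj eqxx. Qed.

(* The cycle C_n; the guard [i != j] in [cycle_adj] matters only for n = 1, so
   that the graph is loopless for every n.  For n >= 3 this is the usual C_n. *)
Definition cycle_graph (n : nat) : sgraph :=
  SGraph (@cycle_adj_sym n) (@cycle_adj_irrefl n).

(* The color set [k] is 'I_k.  For E = {u, v}, [induced c E] is the multiset
   {c u, c v}. *)
Definition induced (G : sgraph) (k : nat) (c : G -> 'I_k) (E : {set G}) :
  {mset 'I_k}%mset := seq_mset [seq c x | x <- enum E].

Definition edge_distinguishing (G : sgraph) (k : nat) (c : G -> 'I_k) : bool :=
  dinjectiveb (induced c) (mem (edges G)).

Definition ed_colorable (G : sgraph) (k : nat) : bool :=
  (0 < k) && [exists c : {ffun G -> 'I_k}, edge_distinguishing c].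

Lemma ed_colorable_ex (G : sgraph) : exists k, ed_colorable G k.
Proof.
exists #|G|.+1; rewrite /ed_colorable /=; apply/existsP.
pose r (x : G) : 'I_#|G|.+1 := widen_ord (leqnSn _) (enum_rank x).
have r_inj : injective r.
  by move=> x y /(congr1 val) /= /val_inj /enum_rank_inj.
exists [ffun x => r x]; apply/dinjectiveP => E F _ _ /eq_seq_msetP /perm_mem eEF.
apply/setP=> x; have := eEF (r x).
have fE (A : {set G}) :
    (r x \in [seq [ffun x0 => r x0] x0 | x0 <- enum A]) = (x \in A).
  rewrite -(mem_enum A) -(mem_map r_inj); congr (_ \in _).
  by apply: eq_map => y; rewrite ffunE.
by rewrite !fE.
Qed.

(* lambda(G) *)
Definition ed_number (G : sgraph) : nat := ex_minn (ed_colorable_ex G).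

(* A partial k-coloring; its domain is the set of vertices not sent to None. *)
Definition pcoloring (G : sgraph) (k : nat) := {ffun G -> option 'I_k}.

Definition colored (G : sgraph) (k : nat) (c : pcoloring G k) : {set G} :=
  [set v | c v != None].

(* For an edge E = {u, v} of G[colored c], [pinduced c E] is the multiset of the
   colors of u and v; its value on other edges is never used. *)
Definition pinduced (G : sgraph) (k : nat) (c : pcoloring G k) (E : {set G}) :
  {mset 'I_k}%mset := seq_mset (pmap c (enum E)).

Definition pedge_distinguishing (G : sgraph) (k : nat) (c : pcoloring G k) :
  bool := dinjectiveb (pinduced c) (mem (edges_in (colored c))).

(* A move (v, a) colors the vertex v with the color a of [lambda(G)]. *)
Definition move (G : sgraph) : Type := (G * 'I_(ed_number G))%type.

Definition play_move (G : sgraph) (c : pcoloring G (ed_number G)) (m : move G) :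
  pcoloring G (ed_number G) := [ffun v => if v == m.1 then Some m.2 else c v].

Definition legal (G : sgraph) (c : pcoloring G (ed_number G)) (m : move G) :
  bool := (m.1 \notin colored c) && pedge_distinguishing (play_move c m).

(* A history is the list of the moves made so far, in chronological order. *)
Definition position (G : sgraph) (h : seq (move G)) :
  pcoloring G (ed_number G) := foldl (@play_move G) [ffun=> None] h.

Variant player := Player1 | Player2.

Definition to_move (G : sgraph) (h : seq (move G)) : player :=
  if odd (size h) then Player2 else Player1.

Definition last_mover (G : sgraph) (h : seq (move G)) : player :=
  if odd (size h) then Player1 else Player2.

Definition finished (G : sgraph) (h : seq (move G)) : Prop :=
  forall m : move G, ~~ legal (position h) m.

Definition strategy (G : sgraph) : Type := seq (move G) -> option (move G).

(* Histories of legal play in which player i obeys s and the opponent is free. *)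
Inductive consistent (G : sgraph) (i : player) (s : strategy G) :
  seq (move G) -> Prop :=
| consistent_nil : consistent i s [::]
| consistent_rcons h m : consistent i s h -> legal (position h) m ->
    (to_move h = i -> s h = Some m) -> consistent i s (rcons h m).

(* The first clause says that s never leaves player i without a prescribed legal
   move while one exists, so that play only stops at a finished history. *)
Definition winning_strategy (G : sgraph) (i : player) (s : strategy G) : Prop :=
  (forall h, consistent i s h -> to_move h = i -> ~ finished h ->
     exists2 m, s h = Some m & legal (position h) m) /\
  (forall h, consistent i s h -> finished h -> last_mover h = i).

Definition has_winning_strategy (G : sgraph) (i : player) : Prop :=
  exists s : strategy G, winning_strategy i s.

(* Main.v *)
(** A vertex with two neighbors of the same color can never be colored: its two
    edges would get the same pair of colors.  Call it blocked.

    After the first two moves of a game on C_n with n >= 5, Player 1 can block a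
    vertex: of the two colored vertices, one can be named u so that neither u-1
    nor u-2 is the other one, and giving u-2 the color of u blocks u-1.  From
    then on at most five vertices of C_6 get colored, so Player 1 only has to
    make sure that the game does not stop with four.  In that case gluing the
    two equally colored neighbors of the blocked vertex leaves a C_4 with
    exactly one uncolored vertex, which can still be colored as soon as there
    are three colors.  There are: an edge-distinguishing k-coloring of C_n
    gives n distinct ordered pairs of consecutive colors, so n <= k^2. *)

From mathcomp Require Import all_boot.
From mathcomp Require Import finmap multiset.
Require Import Defs.

Set Implicit Arguments.
Unset Strict Implicit.
Unset Printing Implicit Defensive.

Lemma perm_eq_pair (T : eqType) (a b a' b' : T) :
  perm_eq [:: a; b] [:: a'; b'] ->
  (a = a' /\ b = b') \/ (a = b' /\ b = a').
Proof.
move=> eq_ab; have := perm_mem eq_ab a.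
rewrite !inE eqxx /= => /esym/orP[]/eqP eq_a; [left|right].
  by move: eq_ab; rewrite eq_a perm_cons => /(@perm_small_eq _ _ [:: _] isT)[].
move: eq_ab; rewrite eq_a (permPr (permEl (perm_catC [:: a'] [:: b']))).
by rewrite perm_cons => /(@perm_small_eq _ _ [:: _] isT)[].
Qed.

Lemma exists_notin (T : finType) (s : seq T) :
  size s < #|T| -> exists x, x \notin s.
Proof.
move=> lt_s; apply/existsP; rewrite -negb_forall; apply: contraL lt_s.
move/forallP=> s_full; rewrite -leqNgt -cardsT.
apply: leq_trans (card_size s); apply/subset_leq_card/subsetP => x _.
exact: s_full.
Qed.

Section PartialColorings.

Variables (G : sgraph) (k : nat).
Implicit Types (c : pcoloring G k) (a b : 'I_k) (u v w : G) (E : {set G}).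

Lemma adj_neq u v : adj u v -> u != v.
Proof. by apply: contraL => /eqP->; rewrite adj_irrefl. Qed.

Definition used_label c a b : bool :=
  [exists u, exists v, [&& adj u v, c u == Some a & c v == Some b]].

Definition blocked c w : bool :=
  [exists u, exists v,
    [&& adj w u, adj w v, u != v, c u != None & c u == c v]].

Lemma used_labelP c a b :
  reflect (exists u v, [/\ adj u v, c u = Some a & c v = Some b])
          (used_label c a b).
Proof.
apply: (iffP existsP) => -[u].
  by case/existsP=> v /and3P[uv /eqP cu /eqP cv]; exists u, v.
case=> v [uv cu cv]; exists u; apply/existsP; exists v.
by rewrite uv cu cv !eqxx.
Qed.

Lemma blockedP c w :
  reflect (exists u v a,
             [/\ adj w u, adj w v, u != v, c u = Some a & c v = Some a])
          (blocked c w).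
Proof.
apply: (iffP existsP) => -[u].
  case/existsP=> v /and5P[wu wv neq_uv]; case cu: (c u) => [a|] // _ /eqP cv.
  by exists u, v, a.
case=> v [a [wu wv neq_uv cu cv]]; exists u; apply/existsP; exists v.
by rewrite wu wv neq_uv cu cv eqxx.
Qed.

Lemma coloredP c u : reflect (exists a, c u = Some a) (u \in colored c).
Proof.
rewrite inE; apply: (iffP idP) => [|[a ->] //].
by case: (c u) => [a|] // _; exists a.
Qed.

Lemma card_colored_lt c w : c w = None -> #|colored c| < #|G|.
Proof.
move=> cw; rewrite -cardsT; apply/proper_card; rewrite properT.
by apply/eqP=> /setP/(_ w); rewrite !inE cw.
Qed.

Lemma colored_none : colored ([ffun=> None] : pcoloring G k) = set0.
Proof. by apply/setP=> v; rewrite !inE ffunE. Qed.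

Lemma edges_in_coloredP c E :
  reflect (exists u v a b,
             [/\ E = [set u; v], adj u v, c u = Some a & c v = Some b])
          (E \in edges_in (colored c)).
Proof.
rewrite !inE; apply: (iffP andP) => [[]|].
  case/existsP=> u /existsP[v /andP[uv /eqP->]].
  rewrite subUset !sub1set => /andP[/coloredP[a cu] /coloredP[b cv]].
  by exists u, v, a, b.
case=> u [v] [a] [b] [-> uv cu cv]; split.
  by apply/existsP; exists u; apply/existsP; exists v; rewrite uv eqxx.
by rewrite subUset !sub1set !inE cu cv.
Qed.

Lemma pinduced_set2 c u v a b :
  adj u v -> c u = Some a -> c v = Some b ->
  pinduced c [set u; v] = seq_mset [:: a; b].
Proof.
move=> uv cu cv; apply/eq_seq_msetP.
have -> : [:: a; b] = pmap c [:: u; v] by rewrite /= cu /= cv.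
apply/perm_pmap/uniq_perm; first exact: enum_uniq.
  by rewrite /= inE adj_neq.
by move=> w; rewrite mem_enum !inE.
Qed.

(* Orienting the edges replaces unordered color pairs by ordered ones. *)
Lemma pedge_distinguishingP c :
  reflect (forall u v u' v' a b, adj u v -> adj u' v' ->
             c u = Some a -> c v = Some b -> c u' = Some a -> c v' = Some b ->
             [set u; v] = [set u'; v'])
          (pedge_distinguishing c).
Proof.
apply: (iffP (dinjectiveP _ _)) => [inj | dist].
  move=> u v u' v' a b uv u'v' cu cv cu' cv'; apply: inj.
  - by apply/edges_in_coloredP; exists u, v, a, b.
  - by apply/edges_in_coloredP; exists u', v', a, b.
  - by rewrite (pinduced_set2 uv cu cv) (pinduced_set2 u'v' cu' cv').
move=> E E' /edges_in_coloredP[u [v [a [b [-> uv cu cv]]]]].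
move=> /edges_in_coloredP[u' [v' [a' [b' [-> u'v' cu' cv']]]]].
rewrite (pinduced_set2 uv cu cv) (pinduced_set2 u'v' cu' cv').
case/eq_seq_msetP/perm_eq_pair=> -[eq_a eq_b]; subst a' b'.
  exact: dist cu cv cu' cv'.
by rewrite [RHS]setUC; apply: dist cu cv cv' cu'; rewrite // adj_sym.
Qed.

Lemma pedge_distinguishing_none :
  pedge_distinguishing ([ffun=> None] : pcoloring G k).
Proof. by apply/pedge_distinguishingP=> u v u' v' a b _ _; rewrite ffunE. Qed.

Lemma pedge_distinguishing_total (c : G -> 'I_k) :
  pedge_distinguishing [ffun v => Some (c v)] = edge_distinguishing c.
Proof.
apply: eq_dinjectiveb => E.
  by congr seq_mset; elim: (enum E) => //= v s ->; rewrite ffunE.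
rewrite !inE andb_idr // => _.
by apply/subsetP=> v _; rewrite inE ffunE.
Qed.

Lemma blocked_uncolored c w :
  pedge_distinguishing c -> blocked c w -> c w = None.
Proof.
move=> /pedge_distinguishingP dist /blockedP[u [v [a [wu wv neq_uv cu cv]]]].
case cw: (c w) => [b|] //.
have /setP/(_ u) := dist w u w v b a wu wv cw cu cw cv.
by rewrite !inE eqxx orbT (negPf neq_uv) eq_sym (negPf (adj_neq wu)).
Qed.

End PartialColorings.

Section Moves.

Variable G : sgraph.
Implicit Types (c : pcoloring G (ed_number G)) (m : move G) (u v w : G).

Lemma colored_play_move c m : colored (play_move c m) = m.1 |: colored c.
Proof. by apply/setP=> v; rewrite !inE ffunE; case: ifP. Qed.

Lemma card_colored_legal c m :
  legal c m -> #|colored (play_move c m)| = #|colored c|.+1.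
Proof. by case/andP=> m_new _; rewrite colored_play_move cardsU1 m_new. Qed.

Lemma legal_distinguishing c m :
  legal c m -> pedge_distinguishing (play_move c m).
Proof. by case/andP. Qed.

Lemma play_move_new c w x : play_move c (w, x) w = Some x.
Proof. by rewrite ffunE eqxx. Qed.

Lemma play_move_old c w x v : v != w -> play_move c (w, x) v = c v.
Proof. by rewrite ffunE => /negPf->. Qed.

Lemma blocked_play_move c m w :
  legal c m -> blocked c w -> blocked (play_move c m) w.
Proof.
case: m => t x /andP[]; rewrite inE negbK /= => /eqP ct _.
case/blockedP=> u [v [a [wu wv neq_uv cu cv]]].
have colored_neq s : c s = Some a -> s != t.
  by apply: contra_eq_neq => ->; rewrite ct.
by apply/blockedP; exists u, v, a; rewrite !play_move_old ?colored_neq.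
Qed.

Section FreshColor.

Variables (c : pcoloring G (ed_number G)) (w : G) (x : 'I_(ed_number G)).
Hypotheses (dist_c : pedge_distinguishing c) (cw : c w = None).
Hypothesis w_free : ~~ blocked c w.
Hypothesis x_fresh :
  forall u a, adj w u -> c u = Some a -> ~~ used_label c a x.

Local Notation c' := (play_move c (w, x)).

Lemma new_edge_unique u s t a :
  adj w u -> adj s t -> c' u = Some a -> c' s = Some x -> c' t = Some a ->
  [set w; u] = [set s; t].
Proof.
move=> wu st c'u c's c't.
have nbr_old v : adj w v -> c' v = c v.
  by move=> wv; rewrite play_move_old // eq_sym adj_neq.
have twin v : adj w v -> c' v = Some a -> v = u.
  move=> wv c'v; apply: contraNeq w_free => neq_vu.
  by apply/blockedP; exists v, u, a; rewrite -(nbr_old v) -?(nbr_old u).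
have [eq_s|neq_s] := eqVneq s w; first by subst s; rewrite (twin t).
have [eq_t|neq_t] := eqVneq t w.
  subst t; rewrite setUC (twin s) 1?adj_sym //.
  by rewrite c's -c't play_move_new.
have /negP[] : ~~ used_label c a x by rewrite (x_fresh wu) // -nbr_old.
apply/used_labelP; exists t, s.
by rewrite adj_sym -(play_move_old c x neq_s) -(play_move_old c x neq_t).
Qed.

Lemma legal_fresh : legal c (w, x).
Proof.
rewrite /legal inE cw eqxx /=.
have c'w y : c' w = Some y -> x = y by rewrite play_move_new => -[].
apply/pedge_distinguishingP=> s t s' t' a b st s't' c's c't c's' c't'.
have [eq_w|sw] := eqVneq s w.
  by subst s; apply: new_edge_unique c't _ c't'; rewrite // c's' (c'w _ c's).
have [eq_w|tw] := eqVneq t w.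
  subst t; rewrite [LHS]setUC [RHS]setUC.
  by apply: new_edge_unique c's _ c's'; rewrite 1?adj_sym // c't' (c'w _ c't).
have [eq_w|s'w] := eqVneq s' w.
  subst s'; apply/esym.
  by apply: new_edge_unique c't' _ c't; rewrite // c's (c'w _ c's').
have [eq_w|t'w] := eqVneq t' w.
  subst t'; rewrite [LHS]setUC [RHS]setUC; apply/esym.
  by apply: new_edge_unique c's' _ c's; rewrite 1?adj_sym // c't (c'w _ c't').
have c'E v : v != w -> c' v = c v by move=> ?; rewrite play_move_old.
by apply: (pedge_distinguishingP _ dist_c _ _ _ _ a b); rewrite // -c'E.
Qed.

End FreshColor.

Lemma legal_uncolored c m :
  pedge_distinguishing c -> colored c = set0 -> legal c m.
Proof.
case: m => w x dist /setP no_color.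
have none v : c v = None by have := no_color v; rewrite !inE; case: (c v).
apply: legal_fresh => // [|u a _]; last by rewrite none.
by apply/blockedP=> -[u [v [a []]]]; rewrite none.
Qed.

Lemma legal_two_colored c u v w x :
  pedge_distinguishing c -> colored c = [set u; v] ->
  w \notin [set u; v] -> ~~ adj w u -> ~~ (adj w v && adj u v) ->
  legal c (w, x).
Proof.
move=> dist col w_new wu path_wvu.
have only_v t a : adj w t -> c t = Some a -> t = v.
  move=> wt ct; have : t \in colored c by apply/coloredP; exists a.
  by rewrite col !inE => /orP[]/eqP // eq_tu; rewrite -eq_tu wt in wu.
apply: legal_fresh => //.
- by apply/eqP; move: w_new; rewrite -col inE negbK.
- apply/blockedP=> -[s [t [a [ws wt]]]] /eqP neq_st cs ct; case: neq_st.
  by rewrite (only_v s a ws cs) (only_v t a wt ct).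
move=> t a wt ct; apply: contraNN path_wvu => /used_labelP[s [s' [ss' cs cs']]].
have wv : adj w v by rewrite -(only_v t a wt ct).
have : s \in [set u; v] by rewrite -col; apply/coloredP; exists a.
have : s' \in [set u; v] by rewrite -col; apply/coloredP; exists x.
have neq_ss' := adj_neq ss'; rewrite wv !inE.
by case/orP=> /eqP eq_s' /orP[]/eqP eq_s; move: ss' neq_ss';
   rewrite eq_s eq_s' ?eqxx // adj_sym.
Qed.

(* If [d] is [y] or [z], any third color will do; otherwise [y] itself will. *)
Lemma exists_legal_between c w u v y z d :
  2 < ed_number G -> pedge_distinguishing c -> c w = None ->
  (forall t, adj w t -> t \in [:: u; v]) ->
  c u = Some y -> c v = Some z -> y != z ->
  (forall a b, used_label c a b ->
     (a == d) && (b \in [:: y; z]) || (b == d) && (a \in [:: y; z])) ->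
  exists x, legal c (w, x).
Proof.
move=> lt2k dist cw nbr_w cu cv neq_yz labels.
have nbr_color t a : adj w t -> c t = Some a -> a \in [:: y; z].
  by move=> /nbr_w; rewrite !inE => /orP[]/eqP->; rewrite ?cu ?cv => -[<-];
     rewrite eqxx ?orbT.
have free : ~~ blocked c w.
  apply/blockedP=> -[s [t [a [/nbr_w ws /nbr_w wt neq_st cs ct]]]].
  case/negP: neq_yz; move: ws wt neq_st cs ct; rewrite !inE.
  by case/orP=> /eqP-> /orP[]/eqP->; rewrite ?eqxx // cu cv => _ [->] [->].
have [d_yz|d_new] := boolP (d \in [:: y; z]).
  have [|x x_new] := @exists_notin _ [:: y; z]; first by rewrite card_ord.
  exists x; apply: legal_fresh => // t a wt ct.
  apply: contraNN x_new => /labels.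
  by case/orP=> /andP[] // /eqP->.
exists y; apply: legal_fresh => // t a wt ct.
apply: contraNN d_new => /labels.
case/orP=> /andP[/eqP<- _]; first exact: nbr_color ct.
by rewrite mem_head.
Qed.

End Moves.

Section Invariant.

Variables (G : sgraph) (safe : pred (pcoloring G (ed_number G))).
Hypothesis safe_start : safe [ffun=> None].
Hypothesis safe_round : forall c, safe c ->
  exists2 m, legal c m &
    forall m', legal (play_move c m) m' -> safe (play_move (play_move c m) m').

Definition keeps_safe c (m : move G) : bool :=
  legal c m &&
  [forall m' : G * 'I_(ed_number G), legal (play_move c m) m' ==>
     safe (play_move (play_move c m) m')].

Definition safe_strategy : strategy G :=
  fun h => [pick m : G * 'I_(ed_number G) | keeps_safe (position h) m].

Lemma position_rcons (h : seq (move G)) m :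
  position (rcons h m) = play_move (position h) m.
Proof. exact: foldl_rcons. Qed.

Lemma safe_strategy_keeps_safe h : safe (position h) ->
  exists2 m, safe_strategy h = Some m & keeps_safe (position h) m.
Proof.
rewrite /safe_strategy => /safe_round[m legal_m safe_m].
case: pickP => [m' keeps|/(_ m)]; first by exists m'.
rewrite /keeps_safe legal_m /=; case/negP; apply/forallP=> m'.
exact/implyP/safe_m.
Qed.

Lemma consistent_safe_strategy h : consistent Player1 safe_strategy h ->
  if odd (size h) then
    forall m, legal (position h) m -> safe (play_move (position h) m)
  else safe (position h).
Proof.
elim=> [//|{}h m _ IHh legal_m]; rewrite size_rcons /to_move /= position_rcons.
case: (odd _) IHh => [safe_reply _|safe_h]; first exact: safe_reply.
have [m' -> /andP[_ /forallP safe_m']] := safe_strategy_keeps_safe safe_h.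
by move=> /(_ erefl)[<-] m''; apply/implyP/safe_m'.
Qed.

(* At Player 1's turns the position is safe, so he is never stuck; a finished
   game is thus one where it is Player 2's turn. *)
Lemma safe_has_winning_strategy : has_winning_strategy G Player1.
Proof.
exists safe_strategy; split=> h /consistent_safe_strategy.
  rewrite /to_move; case: (odd _) => // safe_h _ _.
  have [m eq_m /andP[legal_m _]] := safe_strategy_keeps_safe safe_h.
  by exists m.
rewrite /last_mover; case: (odd _) => // /safe_round[m legal_m _] /(_ m).
by rewrite legal_m.
Qed.

End Invariant.

Lemma val_iter_ordS n d (i : 'I_n) : iter d (@ordS n) i = (i + d) %% n :> nat.
Proof.
elim: d => [|d IHd] /=; first by rewrite addn0 modn_small.
by rewrite IHd -addn1 modnDml addn1 addnS.
Qed.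

Lemma eq_iter_ordS n d e (i : 'I_n) :
  d < n -> e < n -> (iter d (@ordS n) i == iter e (@ordS n) i) = (d == e).
Proof.
by move=> lt_dn lt_en; rewrite -val_eqE /= !val_iter_ordS eqn_modDl !modn_small.
Qed.

Lemma iter_ordS_neq n d (i : 'I_n) : 0 < d < n -> iter d (@ordS n) i != i.
Proof.
case/andP=> d_gt0 lt_dn; rewrite (@eq_iter_ordS n d 0) -?lt0n //.
exact: leq_trans lt_dn.
Qed.

Lemma iter_ordS_full n (i : 'I_n) : iter n (@ordS n) i = i.
Proof. by apply/val_inj; rewrite /= val_iter_ordS modnDr modn_small. Qed.

Lemma iter_ordS_surj n (i j : 'I_n) : exists2 d, d < n & j = iter d (@ordS n) i.
Proof.
have n_gt0 : 0 < n by apply: leq_trans (ltn_ord i).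
exists ((j + n - i) %% n); first by rewrite ltn_mod.
apply/val_inj; rewrite /= val_iter_ordS modnDmr subnKC.
  by rewrite modnDr modn_small.
by rewrite (leq_trans (ltnW (ltn_ord i))) ?leq_addl.
Qed.

Section Cycle.

Variables (n k : nat) (c : pcoloring (cycle_graph n) k).
Hypothesis n_gt2 : 2 < n.
Implicit Types (i j : 'I_n).

Lemma cycle_adjE i j : cycle_adj i j = (j == ordS i) || (i == ordS j).
Proof.
have ordS_neq (l : 'I_n) : (ordS l == l) = false.
  by apply/negbTE/(@iter_ordS_neq n 1); rewrite (leq_trans _ n_gt2).
rewrite /cycle_adj andb_idl // => /orP[]/eqP->; last by rewrite ordS_neq.
by rewrite eq_sym ordS_neq.
Qed.

Lemma cycle_adj_ordS i : @adj (cycle_graph n) i (ordS i).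
Proof. by rewrite /= cycle_adjE eqxx. Qed.

Lemma cycle_edge_inj : injective (fun i => [set i; ordS i]).
Proof.
move=> i j /setP eq_ij.
have /esym := eq_ij i; rewrite !inE eqxx => /orP[/eqP //|/eqP eq_i].
have := eq_ij j; rewrite !inE eqxx eq_i => /orP[/eqP //|/eqP eq_j].
by have := @iter_ordS_neq n 2 j n_gt2; rewrite /= -eq_j eqxx.
Qed.

Lemma cycle_nbr i j : cycle_adj (ordS i) j -> j \in [:: i; ordS (ordS i)].
Proof.
rewrite cycle_adjE !inE.
by case/orP=> [/eqP->|/eqP/ordS_inj->]; rewrite eqxx ?orbT.
Qed.

Lemma cycle_blockedP i :
  reflect (exists2 a, c i = Some a & c (ordS (ordS i)) = Some a)
          (@blocked (cycle_graph n) k c (ordS i)).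
Proof.
apply: (iffP (blockedP _ _)) => [[s [t [a]]]|[a ci cSSi]].
  case=> /cycle_nbr; rewrite !inE => s_nbr /cycle_nbr.
  rewrite !inE => t_nbr neq_st cs ct; exists a; move: neq_st cs ct.
    by case/orP: s_nbr => /eqP->; case/orP: t_nbr => /eqP->; rewrite ?eqxx.
  by case/orP: s_nbr => /eqP->; case/orP: t_nbr => /eqP->; rewrite ?eqxx.
exists i, (ordS (ordS i)), a; rewrite /= !cycle_adjE !eqxx orbT.
by split=> //; rewrite eq_sym; apply: (@iter_ordS_neq n 2).
Qed.

Lemma cycle_used_label i a b :
  used_label c a b ->
  exists2 d, d < n &
    [/\ c (iter d (@ordS n) i) = Some a & c (iter d.+1 (@ordS n) i) = Some b] \/
    [/\ c (iter d (@ordS n) i) = Some b & c (iter d.+1 (@ordS n) i) = Some a].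
Proof.
case/used_labelP=> [u [v [uv cu cv]]].
move: uv; rewrite /= cycle_adjE => /orP[]/eqP eq_v.
  have [d lt_dn eq_u] := iter_ordS_surj i u.
  by exists d; rewrite //= -eq_u -eq_v; left.
have [d lt_dn eq_v'] := iter_ordS_surj i v.
by exists d; rewrite //= -eq_v' -eq_v; right.
Qed.

Lemma cycle_shared_color_neq i j y b z :
  pedge_distinguishing c -> i != j ->
  c i = Some y -> c (ordS i) = Some b -> c j = Some b -> c (ordS j) = Some z ->
  z != y.
Proof.
move=> /pedge_distinguishingP dist neq_ij ci cSi cj cSj.
apply: contraNneq neq_ij => eq_zy; rewrite eq_zy in cSj.
apply/eqP/cycle_edge_inj; rewrite [RHS]setUC.
by apply: dist ci cSi cSj cj; rewrite ?cycle_adj_ordS // adj_sym cycle_adj_ordS.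
Qed.

End Cycle.

Lemma leq_ed_colorable_cycle n k :
  2 < n -> ed_colorable (cycle_graph n) k -> n <= k ^ 2.
Proof.
move=> n_gt2 /andP[_ /existsP[c]]; rewrite -pedge_distinguishing_total.
move=> /pedge_distinguishingP dist.
have pair_inj : injective (fun i : 'I_n => (c i, c (ordS i))).
  move=> i j [eq_c eq_cS]; apply: (cycle_edge_inj n_gt2).
  apply: (dist i (ordS i) j (ordS j) (c i) (c (ordS i)));
    by rewrite ?cycle_adj_ordS ?ffunE ?eq_c ?eq_cS.
by have := leq_card _ pair_inj; rewrite card_prod !card_ord.
Qed.

Lemma leq_ed_number_cycle n : 2 < n -> n <= ed_number (cycle_graph n) ^ 2.
Proof.
move=> n_gt2; apply: leq_ed_colorable_cycle => //.
by rewrite /ed_number; case: ex_minnP.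
Qed.

Section SecondMove.

Variables (n : nat) (c : pcoloring (cycle_graph n) (ed_number (cycle_graph n))).
Hypotheses (n_gt4 : 4 < n) (dist_c : pedge_distinguishing c).

Lemma iter_ordS_neq_le4 d (i : 'I_n) : 0 < d <= 4 -> iter d (@ordS n) i != i.
Proof.
by case/andP=> d_gt0 le_d4; rewrite iter_ordS_neq // d_gt0 (leq_trans _ n_gt4).
Qed.

Lemma blocking_move_at (w v : 'I_n) :
  colored c = [set ordS (ordS w); v] -> v != w -> v != ordS w ->
  exists2 m, legal c m & [exists t, blocked (play_move c m) t].
Proof.
move=> col neq_vw neq_vSw; have n_gt2 : 2 < n by apply: ltn_trans n_gt4.
have neq_uw : ordS (ordS w) != w by apply: (@iter_ordS_neq_le4 2).
have /coloredP[a cu] : ordS (ordS w) \in colored c by rewrite col !inE eqxx.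
have legal_wa : legal c (w, a).
  apply: (@legal_two_colored _ c (ordS (ordS w)) v w a dist_c col).
  - by rewrite !inE negb_or !(eq_sym w) neq_uw.
  - rewrite /= cycle_adjE // negb_or (@iter_ordS_neq_le4 1) // eq_sym.
    exact: (@iter_ordS_neq_le4 3).
  rewrite /= !cycle_adjE // (negPf neq_vSw) /= negb_and.
  have [eq_w|] := eqVneq w (ordS v); last by [].
  rewrite negb_or -eq_w neq_uw andbT eq_w /= eq_sym.
  exact: (@iter_ordS_neq_le4 4).
exists (w, a) => //; apply/existsP; exists (ordS w).
apply/cycle_blockedP=> //; exists a; first exact: play_move_new.
by rewrite -cu; apply: play_move_old.
Qed.

Lemma exists_blocking_move :
  #|colored c| = 2 ->
  exists2 m, legal c m & [exists w, blocked (play_move c m) w].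
Proof.
move=> /eqP/cards2P[u [v [_ col]]].
have two_before (i : 'I_n) : exists j : 'I_n, i = ordS (ordS j).
  by exists (ord_pred (ord_pred i)); rewrite !ord_predK.
have [w eq_u] := two_before u; have [w' eq_v] := two_before v.
have [eq_vw|neq_vw] := eqVneq v w.
  apply: (@blocking_move_at w' u); first by rewrite -eq_v setUC.
    by rewrite eq_u -eq_vw eq_v; apply: (@iter_ordS_neq_le4 4).
  by rewrite eq_u -eq_vw eq_v; apply: (@iter_ordS_neq_le4 3).
have [eq_vSw|neq_vSw] := eqVneq v (ordS w).
  apply: (@blocking_move_at w' u); first by rewrite -eq_v setUC.
    by rewrite eq_u -eq_vSw eq_v; apply: (@iter_ordS_neq_le4 3).
  by rewrite eq_u -eq_vSw eq_v; apply: (@iter_ordS_neq_le4 2).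
by apply: (@blocking_move_at w v); rewrite -?eq_u.
Qed.

End SecondMove.

Section FourCycle.

Variables (n : nat) (c : pcoloring (cycle_graph n) (ed_number (cycle_graph n))).
Variable i : 'I_n.
Hypotheses (n_gt2 : 2 < n) (dist_c : pedge_distinguishing c).

Local Notation v d := (iter d (@ordS n) i).

(* The only colored edges are those leaving [v d] and [v e]: this is a coloring
   of a 4-cycle, with [y], the uncolored [v g.+1], [z], [b] in cyclic order. *)
Lemma cycle_exists_legal_two_edges d e g y z b :
  2 < ed_number (cycle_graph n) ->
  c (v g) = Some y -> c (v g.+1) = None -> c (v g.+2) = Some z ->
  d < n -> c (v d) = Some z -> c (v d.+1) = Some b ->
  e < n -> c (v e) = Some b -> c (v e.+1) = Some y -> d != e ->
  (forall f, f < n -> f != d -> f != e ->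
     c (v f) = None \/ c (v f.+1) = None) ->
  exists x, legal c (v g.+1, x).
Proof.
move=> lt2k cgy cg cgz lt_dn cd cdS lt_en ce ceS neq_de only_de.
apply: (@exists_legal_between _ c (v g.+1) (v g) (v g.+2) y z b) => //.
- by move=> t; apply: cycle_nbr.
- apply: (@cycle_shared_color_neq n _ c n_gt2 (v d) (v e) z b y) => //.
  by rewrite eq_iter_ordS.
move=> s t /(cycle_used_label n_gt2 i)[f lt_fn].
have [->|neq_fd] := eqVneq f d.
  by rewrite cd cdS => -[] [] [<-] [<-]; rewrite !inE !eqxx ?orbT.
have [->|neq_fe] := eqVneq f e.
  by rewrite ce ceS => -[] [] [<-] [<-]; rewrite !inE !eqxx ?orbT.
by case: (only_de f lt_fn neq_fd neq_fe) => -> [] [].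
Qed.

End FourCycle.

Section Hexagon.

Local Notation C6 := (cycle_graph 6).

Lemma ed_number_C6_gt2 : 2 < ed_number C6.
Proof. by have := @leq_ed_number_cycle 6 isT; case: ed_number => [|[|[|]]]. Qed.

Section BlockedVertex.

Variables (c : pcoloring C6 (ed_number C6)) (i : 'I_6).

Local Notation v d := (iter d (@ordS 6) i).

Lemma hexagon_exists_legal_at a (w : 'I_6) :
  pedge_distinguishing c ->
  c (v 0) = Some a -> c (v 1) = None -> c (v 2) = Some a ->
  colored c = ~: [set v 1; w] -> w != v 1 ->
  exists x, legal c (w, x).
Proof.
move=> dist_c c0 c1 c2 col; have [d lt_d6 eq_w] := iter_ordS_surj i w.
rewrite {w}eq_w in col *; rewrite eq_iter_ordS // => neq_d1.
have cd : c (v d) = None.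
  by apply/eqP; move/setP/(_ (v d)): col; rewrite !inE eqxx orbT => /negbFE.
have has_color e : e < 6 -> e != 1 -> e != d -> exists b, c (v e) = Some b.
  move=> lt_e6 neq_e1 neq_ed; apply/coloredP.
  by rewrite col !inE !eq_iter_ordS // negb_or neq_e1.
have c6 : c (v 6) = Some a by rewrite iter_ordS_full.
have lt2k := ed_number_C6_gt2.
case: d lt_d6 neq_d1 cd {col} has_color =>
  [|[|[|[|[|[|//]]]]]] _ // _ cd has_color.
- by rewrite c0 in cd.
- by rewrite c2 in cd.
- have [//|//|//|q c4] := has_color 4; have [//|//|//|r c5] := has_color 5.
  apply: (@cycle_exists_legal_two_edges 6 c i _ _ 4 5 2 a q r) => //.
  by case=> [|[|[|[|[|[|]]]]]] //= _ _ _; auto.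
- have [//|//|//|p c3] := has_color 3; have [//|//|//|r c5] := has_color 5.
  apply: (@cycle_exists_legal_two_edges 6 c i _ _ 5 2 3 p r a) => //.
  by case=> [|[|[|[|[|[|]]]]]] //= _ _ _; auto.
have [//|//|//|p c3] := has_color 3; have [//|//|//|q c4] := has_color 4.
apply: (@cycle_exists_legal_two_edges 6 c i _ _ 2 3 4 q a p) => //.
by case=> [|[|[|[|[|[|]]]]]] //= _ _ _; auto.
Qed.

End BlockedVertex.

Implicit Types c : pcoloring C6 (ed_number C6).

Lemma hexagon_exists_legal_blocked c w :
  pedge_distinguishing c -> blocked c w -> #|colored c| = 4 ->
  exists m, legal c m.
Proof.
move=> dist_c block_w card4; have cw := blocked_uncolored dist_c block_w.
have [i eq_w] : exists i : 'I_6, w = ordS i.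
  by exists (ord_pred w); rewrite ord_predK.
rewrite {w}eq_w in block_w cw.
have [a ci cSSi] : exists2 a, c i = Some a & c (ordS (ordS i)) = Some a.
  exact/cycle_blockedP.
have [u col neq_u] :
    exists2 u : 'I_6, colored c = ~: [set ordS i; u] & u != ordS i.
  have /cards2P[x [y [neq_xy eqC]]] : #|~: colored c| == 2.
    by rewrite -(eqn_add2l #|colored c|) cardsC card4 card_ord.
  have : ordS i \in [set x; y] by rewrite -eqC !inE cw.
  rewrite -[colored c]setCK eqC in_set2 => /orP[]/eqP->.
    by exists y; rewrite // eq_sym.
  by exists x; rewrite // setUC.
have [x legal_ux] := hexagon_exists_legal_at dist_c ci cw cSSi col neq_u.
by exists (u, x).
Qed.

Definition hexagon_safe c : bool :=
  [&& pedge_distinguishing c, ~~ odd #|colored c| &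
      (2 < #|colored c|) ==> [exists w, blocked c w]].

Lemma hexagon_safe_exists_move c : hexagon_safe c ->
  exists2 m, legal c m &
    (0 < #|colored c|) ==> [exists w, blocked (play_move c m) w].
Proof.
case/and3P=> dist_c even_c blocked_c.
have [eq0|card_gt0] := posnP #|colored c|.
  have k_gt0 : 0 < ed_number C6 by apply: ltnW (ltnW ed_number_C6_gt2).
  exists (ord0, Ordinal k_gt0) => //.
  by apply: legal_uncolored => //; apply/eqP; rewrite -cards_eq0 eq0.
rewrite /=.
have [eq2|neq2] := eqVneq #|colored c| 2; first exact: exists_blocking_move.
have gt2 : 2 < #|colored c|.
  by move: even_c neq2 card_gt0 {blocked_c}; case: #|_| => [|[|[|]]].
have /existsP[w block_w] := implyP blocked_c gt2.
have cw := blocked_uncolored dist_c block_w.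
have lt6 : #|colored c| < 6.
  by apply: leq_trans (card_colored_lt cw) _; rewrite /= card_ord.
have eq4 : #|colored c| = 4.
  by move: even_c gt2 lt6; case: #|_| => [|[|[|[|[|[|]]]]]].
have [m legal_m] := hexagon_exists_legal_blocked dist_c block_w eq4.
exists m => //; apply/existsP; exists w.
exact: blocked_play_move.
Qed.

End Hexagon.

Theorem theorem3p15 : has_winning_strategy (cycle_graph 6) Player1.
Proof.
apply: (@safe_has_winning_strategy _ hexagon_safe).
  by rewrite /hexagon_safe pedge_distinguishing_none colored_none cards0.
move=> c safe_c; have [m legal_m block_m] := hexagon_safe_exists_move safe_c.
exists m => // m' legal_m'; have /and3P[_ even_c _] := safe_c.
rewrite /hexagon_safe (legal_distinguishing legal_m') /=.
rewrite (card_colored_legal legal_m') (card_colored_legal legal_m) /=.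
rewrite negbK even_c.
apply/implyP=> gt0; have /existsP[w block_w] := implyP block_m gt0.
by apply/existsP; exists w; apply: blocked_play_move.
Qed.
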